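(* Let $p=[p_1\exp_{\lambda^1},\dots,p_m\exp_{\lambda^m}]^T$ with $p_i\in A=\mathbb C[t_1,\dots,t_n]$ and $\lambda^i\in\mathbb C^n$. Partition $\{1,\dots,m\}=K_1\,\dot\cup\cdots\dot\cup\,K_l$ into the classes of indices with equal exponent vector, $K_i=\{k_{i1}<\dots<k_{il_i}\}$ with common exponent $\mu^i:=\lambda^{k_{i1}}$. Put $h_i=[p_{k_{i1}},\dots,p_{k_{il_i}}]^T\in A^{l_i}$, $H_i=\sigma_{\mu^i}(\ker(\kappa_{h_i}))\subseteq\mathcal W_n^{1\times l_i}$ ($\sigma_{\mu^i}$ applied entrywise), and $\phi_i:\mathcal W_n^{1\times l_i}\to\mathcal W_n^{1\times m}$, $[a_1,\dots,a_{l_i}]\mapsto\sum_{j=1}^{l_i}a_je_{k_{ij}}$. Then $$\{a\in\mathcal W_n^{1\times m}:\textstyle\sum_{j=1}^m a_j\bullet(p_j\exp_{\lambda^j})=0\}=\bigoplus_{i=1}^l\phi_i(H_i),$$ and consequently a matrix whose rows generate $\bigoplus_i\phi_i(H_i)$ is a kernel representation of the VMPUM of $\{p\}$.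
   Context: $\mathcal W_n$ is the $n$-th Weyl algebra $\mathbb C[t_1,\dots,t_n]\langle\partial_1,\dots,\partial_n\rangle$ with $\partial_it_j=t_j\partial_i+\delta_{ij}$, acting on $C^\infty(\mathbb R^n,\mathbb C)$ by $\partial_i\bullet f=\partial f/\partial t_i$ and multiplication by $t_i$. For $\lambda\in\mathbb C^n$, $\exp_\lambda=\exp(\lambda_1t_1+\dots+\lambda_nt_n)$. For $q\in A^k$, $\ker(\kappa_q)=\{a\in\mathcal W_n^{1\times k}:\sum_ia_i\bullet q_i=0\}$. For $\lambda\in\mathbb C^n$, $\sigma_\lambda$ is the $\mathbb C$-algebra automorphism of $\mathcal W_n$ with $t_i\mapsto t_i$, $\partial_i\mapsto\partial_i-\lambda_i$. $e_k$ are the canonical basis vectors of $\mathcal W_n^{1\times m}$. The VMPUM of a set $\Omega$ of signals is the smallest solution set $\{g:R\bullet g=0\}$ ($R$ a matrix over $\mathcal W_n$) containing $\Omega$. *)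

(* Defs.v *)
From Stdlib Require Import Reals ClassicalEpsilon ClassicalDescription.
From mathcomp Require Import all_boot.
Set Implicit Arguments. Unset Strict Implicit. Unset Printing Implicit Defensive.
Local Open Scope R_scope.

Record Cplx := mkC { Re : R; Im : R }.
Definition C0 : Cplx := mkC 0 0.
Definition C1 : Cplx := mkC 1 0.
Definition RC (r : R) : Cplx := mkC r 0.
Definition Cadd (x y : Cplx) : Cplx := mkC (Re x + Re y) (Im x + Im y).
Definition Copp (x : Cplx) : Cplx := mkC (- Re x) (- Im x).
Definition Cmul (x y : Cplx) : Cplx :=
  mkC (Re x * Re y - Im x * Im y) (Re x * Im y + Im x * Re y).
Definition Csum (T : Type) (s : seq T) (F : T -> Cplx) : Cplx :=
  foldr (fun x acc => Cadd (F x) acc) C0 s.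
Definition Cprod (T : Type) (s : seq T) (F : T -> Cplx) : Cplx :=
  foldr (fun x acc => Cmul (F x) acc) C1 s.
Definition Rsum (T : Type) (s : seq T) (F : T -> R) : R :=
  foldr (fun x acc => (F x + acc)) 0 s.

Definition pt (n : nat) := 'I_n -> R.
Definition fn (n : nat) := pt n -> Cplx.
Definition mi (n : nat) := 'I_n -> nat.
Definition mi0 (n : nat) : mi n := fun _ => 0%N.
Definition mieq (n : nat) (a b : mi n) : bool := [forall i, a i == b i].
Definition incr (n : nat) (i : 'I_n) (a : mi n) : mi n :=
  fun j => if j == i then (a j).+1 else a j.
Definition decr (n : nat) (i : 'I_n) (a : mi n) : mi n :=
  fun j => if j == i then (a j).-1 else a j.

Definition mono (n : nat) (al : mi n) (x : pt n) : Cplx :=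
  Cprod (enum 'I_n) (fun i => RC (x i ^ al i)).

Definition mpoly (n : nat) := seq (Cplx * mi n).
Definition peval (n : nat) (p : mpoly n) : fn n :=
  fun x => Csum p (fun m => Cmul m.1 (mono m.2 x)).

Definition expC (n : nat) (lam : 'I_n -> Cplx) : fn n := fun x =>
  let a := Rsum (enum 'I_n) (fun i => Re (lam i) * x i) in
  let b := Rsum (enum 'I_n) (fun i => Im (lam i) * x i) in
  mkC (exp a * cos b) (exp a * sin b).

Definition upd (n : nat) (x : pt n) (i : 'I_n) (s : R) : pt n :=
  fun j => if j == i then (x i + s) else x j.
Definition is_pd (n : nat) (i : 'I_n) (f g : fn n) : Prop :=
  forall x, derivable_pt_lim (fun s => Re (f (upd x i s))) 0 (Re (g x)) /\
            derivable_pt_lim (fun s => Im (f (upd x i s))) 0 (Im (g x)).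
(* the partial derivative d f / d t_i (chosen; meaningful when it exists) *)
Definition pd (n : nat) (i : 'I_n) (f : fn n) : fn n :=
  epsilon (inhabits (fun _ => C0)) (fun g => is_pd i f g).
Fixpoint diff_along (n : nat) (ls : seq 'I_n) (f : fn n) : Prop :=
  match ls with
  | [::] => True
  | i :: ls' => (exists g, is_pd i f g) /\ diff_along ls' (pd i f)
  end.
Definition Cinf (n : nat) (f : fn n) : Prop := forall ls : seq 'I_n, diff_along ls f.
Definition dpow (n : nat) (be : mi n) (f : fn n) : fn n :=
  foldr (fun i g => iter (be i) (pd i) g) f (enum 'I_n).

(* ---------- the Weyl algebra W_n ----------
   An element is a finite list of normally ordered terms c t^alpha d^beta;
   two lists denote the same element iff they have the same coefficients. *)
Definition weyl (n : nat) := seq (Cplx * (mi n * mi n)).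
Definition coef (n : nat) (a : weyl n) (al be : mi n) : Cplx :=
  Csum a (fun m => if mieq m.2.1 al && mieq m.2.2 be then m.1 else C0).
Definition weq (n : nat) (a b : weyl n) : Prop :=
  forall al be, coef a al be = coef b al be.
Definition wzero (n : nat) : weyl n := [::].
Definition wsum (n : nat) (T : Type) (s : seq T) (F : T -> weyl n) : weyl n :=
  flatten (map F s).
Definition wscale (n : nat) (c : Cplx) (a : weyl n) : weyl n :=
  map (fun m => (Cmul c m.1, m.2)) a.
Definition tmul (n : nat) (i : 'I_n) (a : weyl n) : weyl n :=
  map (fun m => (m.1, (incr i m.2.1, m.2.2))) a.
(* left multiplication by d_i :  d_i t^al d^be = t^al d^(be+e_i) + al_i t^(al-e_i) d^be *)
Definition dmul (n : nat) (i : 'I_n) (a : weyl n) : weyl n :=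
  flatten (map (fun m => [:: (m.1, (m.2.1, incr i m.2.2));
                             (Cmul (RC (INR (m.2.1 i))) m.1, (decr i m.2.1, m.2.2))]) a).
Definition tpow (n : nat) (al : mi n) (a : weyl n) : weyl n :=
  foldr (fun i acc => iter (al i) (tmul i) acc) a (enum 'I_n).
Definition dpoww (n : nat) (be : mi n) (a : weyl n) : weyl n :=
  foldr (fun i acc => iter (be i) (dmul i) acc) a (enum 'I_n).
Definition wmul (n : nat) (a b : weyl n) : weyl n :=
  flatten (map (fun m => tpow m.2.1 (dpoww m.2.2 (wscale m.1 b))) a).
(* sigma_lambda : t_i |-> t_i, d_i |-> d_i - lambda_i *)
Definition sigma (n : nat) (lam : 'I_n -> Cplx) (a : weyl n) : weyl n :=
  flatten (map (fun m => tpow m.2.1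
     (foldr (fun i acc => iter (m.2.2 i) (fun y => dmul i y ++ wscale (Copp (lam i)) y) acc)
            [:: (m.1, (@mi0 n, @mi0 n))] (enum 'I_n))) a).
Definition act (n : nat) (a : weyl n) (f : fn n) : fn n := fun x =>
  Csum a (fun m => Cmul m.1 (Cmul (mono m.2.1 x) (dpow m.2.2 f x))).

Definition ann (n m : nat) (a : 'I_m -> weyl n) (g : 'I_m -> fn n) : Prop :=
  forall x, Csum (enum 'I_m) (fun j => act (a j) (g j) x) = C0.

Section Setting.
Variables (n m : nat) (P : 'I_m -> mpoly n) (lam : 'I_m -> 'I_n -> Cplx).

Definition sig_p : 'I_m -> fn n := fun j x => Cmul (peval (P j) x) (expC (lam j) x).

Definition kerp (a : 'I_m -> weyl n) : Prop := ann a sig_p.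

Definition pbool (Q : Prop) : bool := if excluded_middle_informative Q then true else false.
Definition cls (k : 'I_m) : {set 'I_m} := [set j | pbool (lam j = lam k)].
Definition classes : {set {set 'I_m}} := [set cls k | k : 'I_m].
Definition mu (K : {set 'I_m}) : 'I_n -> Cplx :=
  if enum K is j :: _ then lam j else fun _ => C0.
(* ker(kappa_{h_K}), h_K = [p_{k_1},...,p_{k_l}] with k_j = enum_val j increasing *)
Definition kerh (K : {set 'I_m}) (c : 'I_#|K| -> weyl n) : Prop :=
  forall x, Csum (enum 'I_#|K|) (fun j => act (c j) (peval (P (enum_val j))) x) = C0.
Definition HK (K : {set 'I_m}) (b : 'I_#|K| -> weyl n) : Prop :=
  exists c, kerh c /\ forall j, weq (b j) (sigma (mu K) (c j)).
Definition phi (K : {set 'I_m}) (b : 'I_#|K| -> weyl n) : 'I_m -> weyl n :=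
  fun k => wsum (enum 'I_#|K|) (fun j => if enum_val j == k then b j else @wzero n).

Definition dsum_of (b : forall K : {set 'I_m}, 'I_#|K| -> weyl n) : 'I_m -> weyl n :=
  fun k => wsum (enum classes) (fun K => phi (b K) k).
Definition inDS (a : 'I_m -> weyl n) : Prop :=
  exists b : forall K : {set 'I_m}, 'I_#|K| -> weyl n,
    (forall K, K \in classes -> HK (b K)) /\ forall k, weq (a k) (dsum_of b k).
Definition DS_direct : Prop :=
  forall b : forall K : {set 'I_m}, 'I_#|K| -> weyl n,
    (forall K, K \in classes -> HK (b K)) ->
    (forall k, weq (dsum_of b k) (@wzero n)) ->
    forall K, K \in classes -> forall j, weq (b K j) (@wzero n).
End Setting.

Definition solR (n m r : nat) (Rm : 'I_r -> 'I_m -> weyl n) (g : 'I_m -> fn n) : Prop :=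
  (forall j, Cinf (g j)) /\ forall k, ann (Rm k) g.
Definition genby (n m r : nat) (Rm : 'I_r -> 'I_m -> weyl n) (a : 'I_m -> weyl n) : Prop :=
  exists c : 'I_r -> weyl n,
    forall j, weq (a j) (wsum (enum 'I_r) (fun k => wmul (c k) (Rm k j))).
Definition vmpum_rep (n m r : nat) (Rm : 'I_r -> 'I_m -> weyl n) (w : 'I_m -> fn n) : Prop :=
  solR Rm w /\
  forall (r' : nat) (R' : 'I_r' -> 'I_m -> weyl n),
    solR R' w -> forall g, solR Rm g -> solR R' g.

(* Main.v *)
(** Write each signal entry as a polynomial times its exponential. Multiplying by exp_mu
    intertwines d_i with d_i - mu_i, so sigma_mu(c) acts on q exp_mu as c acts on q; and as
    polynomial multiples of distinct exponentials are linearly independent (they lie in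
    generalized eigenspaces of the d_i for distinct joint eigenvalues), a row annihilates p iff
    each of its blocks does. The inverse sigma_{-mu} of sigma_mu is recognised through the
    faithfulness of the action on exponentials. For the VMPUM, the W_n-action on smooth
    functions must be a module structure, which rests on the symmetry of mixed partials. *)
From Stdlib Require Import Reals Lra Classical ClassicalEpsilon ClassicalDescription FunctionalExtensionality.
From HB Require Import structures.
From mathcomp Require Import all_boot.
Require Import Defs.
Set Implicit Arguments. Unset Strict Implicit. Unset Printing Implicit Defensive.
Local Open Scope R_scope.

(** * Symmetry of mixed partial derivatives *)

(** Elements of [W_n] are lists of terms taken up to [weq], and identities between them are tested
    on functions. The exponentials are the right test functions: an element with coefficients
    c_{al,be} sends exp_l to its symbol, the sum of c_{al,be} t^al l^be, times exp_l, so that every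
    coefficient can be read off. One independence statement for generalized eigenspaces serves
    twice: with the Euler operators t_i d_i it separates the monomials of a symbol, with the d_i it
    separates the classes of exponents. Directness of the sum is a matter of disjoint supports. The
    delicate point is the action itself: smoothness gives separate continuity of the derivatives
    only, so mixed partials are compared by a Baire category argument on a line. *)

Lemma baire_interval (A : nat -> R -> Prop) (a b : R) : a < b ->
  (forall n x, ~ A n x -> exists2 d, 0 < d & forall y, Rabs (y - x) < d -> ~ A n y) ->
  (forall x, exists n, A n x) ->
  exists n c d, [/\ a <= c, c < d, d <= b & forall x, c <= x <= d -> A n x].
Proof.
move=> ab clA covA; apply: NNPP => noI.
(* If no [A n] contains a nondegenerate closed subinterval, each subinterval can be shrunk to one
   that misses [A n]. The conditions on [p] stand behind the existential so that choice yields a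
   total function [step]. *)
have sub n (p : R * R) : exists q : R * R, a <= p.1 -> p.1 < p.2 -> p.2 <= b ->
    [/\ p.1 <= q.1, q.1 < q.2, q.2 <= p.2 & forall x, q.1 <= x <= q.2 -> ~ A n x].
  case: p => c d /=.
  case: (classic [/\ a <= c, c < d & d <= b]) => [[ac cd db]|H]; last first.
    by exists (0, 0) => *; case: H.
  have [x [xc xd nAx]] : exists x, [/\ c <= x, x <= d & ~ A n x].
    apply: NNPP => H; apply: noI; exists n, c, d; split=> // x [cx xd].
    by apply: NNPP => nA; apply: H; exists x.
  have [e e0 He] := clA _ _ nAx.
  (* Halving [e] keeps this closed interval inside the open ball where [A n] fails; as [x] lies in
     [c, d], clipping leaves it nondegenerate. *)
  exists (Rmax c (x - e / 2), Rmin d (x + e / 2)) => _ _ _ /=.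
  have := Rmax_l c (x - e/2); have := Rmin_l d (x + e/2).
  have := Rmax_r c (x - e/2); have := Rmin_r d (x + e/2).
  split=> //.
    by apply: Rmax_lub_lt; apply: Rmin_glb_lt; lra.
  move=> y [y1 y2]; apply: He; apply: Rabs_def1; lra.
pose step n p := proj1_sig (constructive_indefinite_description _ (sub n p)).
pose u := fix u n := if n is k.+1 then step k (u k) else (a, b).
have uS n : a <= (u n).1 -> (u n).1 < (u n).2 -> (u n).2 <= b ->
    [/\ (u n).1 <= (u n.+1).1, (u n.+1).1 < (u n.+1).2, (u n.+1).2 <= (u n).2
      & forall x, (u n.+1).1 <= x <= (u n.+1).2 -> ~ A n x].
  by rewrite /= /step; case: constructive_indefinite_description.
have uI n : [/\ a <= (u n).1, (u n).1 < (u n).2 & (u n).2 <= b].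
  elim: n => [|n [h1 h2 h3]]; first by split=> /=; lra.
  by case: (uS n h1 h2 h3) => *; split=> //; lra.
have uM n k : (u n).1 <= (u (n + k)%N).1 /\ (u (n + k)%N).2 <= (u n).2.
  elim: k => [|k [h1 h2]]; first by rewrite addn0; lra.
  case: (uI (n + k)%N) => g1 g2 g3; case: (uS _ g1 g2 g3); rewrite addnS; lra.
have uX n k : (u n).1 <= (u k).2.
  have := uM n k; have := uM k n; rewrite addnC; case: (uI (n + k)%N); lra.
(* The supremum of the left endpoints lies in all the nested intervals, hence in no [A n]. *)
have [z [zub zlub]] : { z | is_lub (fun x => exists n, x = (u n).1) z }.
  apply: completeness; last by exists a, 0%N.
  by exists b => x [n ->]; have := uX n 0%N.
have [n] := covA z.
case: (uI n) => g1 g2 g3; case: (uS _ g1 g2 g3) => _ _ _; apply.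
split; first by apply: zub; exists n.+1.
by apply: zlub => x [k ->].
Qed.

Lemma MVT_lim (f f' : R -> R) (a b : R) :
  (forall x, derivable_pt_lim f x (f' x)) -> a < b ->
  exists2 c, a < c < b & f b - f a = f' c * (b - a).
Proof.
move=> df ab.
have [c [H1 H2]] := MVT_cor2 f f' a b ab (fun c _ => df c).
by exists c.
Qed.

(** A bound on forward difference quotients survives the limit. It is used once for each variable of
    a double difference. *)
Lemma derivable_quotient_le (f : R -> R) (x l c e r : R) : derivable_pt_lim f x l -> 0 < r ->
  (forall h, 0 < h < r -> Rabs (f (x + h) - f x - c * h) <= e * h) -> Rabs (l - c) <= e.
Proof.
move=> df r0 H; apply: Rnot_lt_le => lt.
have [d Hd] := df ((Rabs (l - c) - e) / 2) ltac:(lra).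
have d0 := cond_pos d.
pose h := Rmin (d / 2) (r / 2).
have h0 : 0 < h by apply: Rmin_glb_lt; lra.
have hd : h <= d / 2 := Rmin_l _ _.
have hr : h <= r / 2 := Rmin_r _ _.
have := Hd h ltac:(lra) ltac:(rewrite Rabs_right; lra).
have Hh := H h ltac:(lra).
have : Rabs ((f (x + h) - f x) / h - c) <= e.
  have -> : (f (x + h) - f x) / h - c = (f (x + h) - f x - c * h) / h by field; lra.
  rewrite /Rdiv Rabs_mult (Rabs_right (/ h)); last by apply: Rle_ge; apply: Rlt_le; apply: Rinv_0_lt_compat.
  by apply: (Rmult_le_reg_r h) => //; rewrite Rmult_assoc Rinv_l; lra.
have := Rabs_triang (l - (f (x + h) - f x) / h) ((f (x + h) - f x) / h - c).
rewrite (Rabs_minus_sym l).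
have -> : l - (f (x + h) - f x) / h + ((f (x + h) - f x) / h - c) = l - c by ring.
lra.
Qed.

(* By Baire, every interval on the line [y = y0] contains a subinterval over which [fxy] stays close
   to its value on the line, uniformly for [y] near [y0]; there the mean value theorem for double
   differences compares [fxy] with [fyx]. *)
Lemma mixed_partials (f fx fy fxy fyx : R -> R -> R) :
  (forall x y, derivable_pt_lim (fun s => f s y) x (fx x y)) ->
  (forall x y, derivable_pt_lim (fun t => f x t) y (fy x y)) ->
  (forall x y, derivable_pt_lim (fun t => fx x t) y (fxy x y)) ->
  (forall x y, derivable_pt_lim (fun s => fy s y) x (fyx x y)) ->
  (forall x y, continuity_pt (fun s => fxy s y) x) ->
  (forall x y, continuity_pt (fun t => fxy x t) y) ->
  (forall x y, continuity_pt (fun s => fyx s y) x) ->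
  forall x y, fxy x y = fyx x y.
Proof.
move=> dx dy dxy dyx cx cy cyx x0 y0.
have ctn (g : R -> R) x e : continuity_pt g x -> 0 < e ->
    exists2 d, 0 < d & forall y, Rabs (y - x) < d -> Rabs (g y - g x) < e.
  move=> cg e0; have [d [d0 Hd]] := cg e e0; exists d => // y yd.
  case: (Req_dec y x) => [->|ne]; first by rewrite Rminus_diag Rabs_R0.
  by apply: Hd; split=> //; split=> //; apply: nesym.
have dense e a b : 0 < e -> a < b -> exists2 x, a <= x <= b & Rabs (fxy x y0 - fyx x y0) <= 4 * e.
  move=> e0 ab.
  (* [A n] collects the [x] at which the radius 1/(n+1) serves the tolerance [e] for continuity in
     [y] at [y0]. Continuity of [fxy] in [x] makes it closed, continuity in [y] makes these sets
     cover the line. *)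
  pose A n x := forall y, Rabs (y - y0) <= / INR n.+1 -> Rabs (fxy x y - fxy x y0) <= e.
  have clA n x : ~ A n x -> exists2 d, 0 < d & forall y, Rabs (y - x) < d -> ~ A n y.
    move=> nA; have [y Hy] := not_all_ex_not _ _ nA.
    have [yn /Rnot_le_lt big] := imply_to_and _ _ Hy.
    (* Half the excess over [e]: replacing [x] by a nearby [z] in both terms then costs less than
       the whole excess. *)
    pose k := (Rabs (fxy x y - fxy x y0) - e) / 2.
    have [d1 d10 H1] := ctn _ _ k (cx x y) ltac:(rewrite /k; lra).
    have [d2 d20 H2] := ctn _ _ k (cx x y0) ltac:(rewrite /k; lra).
    exists (Rmin d1 d2); first exact: Rmin_glb_lt.
    move=> z zd Az; have := Az y yn.
    have := H1 z (Rlt_le_trans _ _ _ zd (Rmin_l d1 d2)).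
    have := H2 z (Rlt_le_trans _ _ _ zd (Rmin_r d1 d2)).
    rewrite (Rabs_minus_sym (fxy z y)).
    have := Rabs_triang (fxy x y - fxy z y) (fxy z y - fxy z y0).
    have := Rabs_triang (fxy x y - fxy z y + (fxy z y - fxy z y0)) (fxy z y0 - fxy x y0).
    have -> : fxy x y - fxy z y + (fxy z y - fxy z y0) + (fxy z y0 - fxy x y0) = fxy x y - fxy x y0 by ring.
    rewrite /k; lra.
  have covA x : exists n, A n x.
    have [d d0 Hd] := ctn _ _ e (cy x y0) e0.
    have [n [n1 n2]] := archimed_cor1 d d0.
    exists n => y yn; apply: Rlt_le; apply: Hd; apply: Rle_lt_trans yn _.
    apply: Rle_lt_trans n1; apply: Rinv_le_contravar; first exact: lt_0_INR.
    by rewrite S_INR; lra.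
  have [n [c [d [ac cd db HA]]]] := baire_interval ab clA covA.
  rewrite /A in HA; have [d1 d10 H1] := ctn _ _ e (cx c y0) e0.
  have n0 : 0 < / INR n.+1 by apply: Rinv_0_lt_compat; apply: lt_0_INR; apply/ltP.
  set r := / INR n.+1 in HA n0.
  exists c; first by lra.
  pose q := Rmin d1 (d - c).
  have q0 : 0 < q by apply: Rmin_glb_lt; lra.
  have q1 : q <= d1 := Rmin_l _ _.
  have q2 : q <= d - c := Rmin_r _ _.
  (* One [e] comes from [HA], uniformly in [x], the other from continuity of [fxy] in [x] along the
     line [y = y0]. *)
  have near x y : c <= x < c + q -> y0 <= y <= y0 + r -> Rabs (fxy x y - fxy c y0) <= 2 * e.
    move=> xc yr.
    have := HA x ltac:(lra) y ltac:(rewrite Rabs_right; lra).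
    have := H1 x ltac:(rewrite Rabs_right; lra).
    have := Rabs_triang (fxy x y - fxy x y0) (fxy x y0 - fxy c y0).
    have -> : fxy x y - fxy x y0 + (fxy x y0 - fxy c y0) = fxy x y - fxy c y0 by ring.
    lra.
  rewrite Rabs_minus_sym; apply: Rle_trans (_ : 2 * e <= _); last lra.
  (* The double difference over an [s] by [t] rectangle differs from [fxy c y0 * s * t] by at most
     [2 * e * s * t]. The limit in [t], then in [s], turns this into the bound on the mixed
     partials. *)
  apply: (derivable_quotient_le (dyx c y0) q0) => s sq.
  have dys : derivable_pt_lim (fun t => f (c + s) t - f c t) y0 (fy (c + s) y0 - fy c y0).
    by apply: derivable_pt_lim_minus.
  have := @derivable_quotient_le _ _ _ (fxy c y0 * s) (2 * e * s) r dys n0; apply=> t tr.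
  have [xi xiI Exi] := @MVT_lim (fun x => f x (y0 + t) - f x y0) (fun x => fx x (y0 + t) - fx x y0)
    c (c + s) (fun x => derivable_pt_lim_minus _ _ _ _ _ (dx x (y0 + t)) (dx x y0)) ltac:(lra).
  have [eta etaI Eeta] := @MVT_lim (fun y => fx xi y) (fun y => fxy xi y) y0 (y0 + t) (dxy xi) ltac:(lra).
  have -> : f (c + s) (y0 + t) - f c (y0 + t) - (f (c + s) y0 - f c y0) - fxy c y0 * s * t
      = (fxy xi eta - fxy c y0) * (s * t) by rewrite /= in Exi Eeta; nra.
  rewrite Rabs_mult (Rabs_right (s * t)); last by nra.
  have := near xi eta ltac:(lra) ltac:(lra).
  have : 0 < s * t by nra.
  nra.
apply: cond_eq => e e0.
have [d1 d10 H1] := ctn _ _ (e / 6) (cx x0 y0) ltac:(lra).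
have [d2 d20 H2] := ctn _ _ (e / 6) (cyx x0 y0) ltac:(lra).
have d0 : 0 < Rmin d1 d2 by apply: Rmin_glb_lt.
have m1 := Rmin_l d1 d2; have m2 := Rmin_r d1 d2.
(* The three errors add up to [4 * (e / 12) + e / 6 + e / 6 < e]. *)
have [x xI Hx] := dense (e / 12) x0 (x0 + Rmin d1 d2 / 2) ltac:(lra) ltac:(lra).
have := H1 x ltac:(rewrite Rabs_right; lra).
have := H2 x ltac:(rewrite Rabs_right; lra).
rewrite (Rabs_minus_sym (fxy x y0) (fxy x0 y0)).
have := Rabs_triang (fxy x0 y0 - fxy x y0) (fxy x y0 - fyx x y0).
have := Rabs_triang (fxy x0 y0 - fxy x y0 + (fxy x y0 - fyx x y0)) (fyx x y0 - fyx x0 y0).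
have -> : fxy x0 y0 - fxy x y0 + (fxy x y0 - fyx x y0) + (fyx x y0 - fyx x0 y0) = fxy x0 y0 - fyx x0 y0 by ring.
lra.
Qed.

(** * Complex-valued functions *)

Declare Scope cplx_scope.
Delimit Scope cplx_scope with C.
Bind Scope cplx_scope with Cplx.
Notation "x + y" := (Cadd x y) : cplx_scope.
Notation "x * y" := (Cmul x y) : cplx_scope.
Notation "- x" := (Copp x) : cplx_scope.
Notation "x - y" := (Cadd x (Copp y)) : cplx_scope.
Notation "0" := C0 : cplx_scope.
Notation "1" := C1 : cplx_scope.
Notation "\sum_ ( i <- r ) F" := (\big[Cadd/C0]_(i <- r) F%C) : cplx_scope.

Lemma Cplx_eq (x y : Cplx) : Re x = Re y -> Im x = Im y -> x = y.
Proof. by case: x => a b; case: y => c d /= -> ->. Qed.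

Lemma Cplx_ring : ring_theory C0 C1 Cadd Cmul (fun x y => Cadd x (Copp y)) Copp eq.
Proof. by split=> *; apply: Cplx_eq => /=; ring. Qed.
Add Ring Cplx_ring : Cplx_ring.

Lemma CaddA : associative Cadd. Proof. by move=> x y z; ring. Qed.
Lemma CaddC : commutative Cadd. Proof. by move=> x y; ring. Qed.
Lemma Cadd0 : left_id C0 Cadd. Proof. by move=> x; ring. Qed.
Lemma CmulA : associative Cmul. Proof. by move=> x y z; ring. Qed.
Lemma CmulC : commutative Cmul. Proof. by move=> x y; ring. Qed.
Lemma Cmul1 : left_id C1 Cmul. Proof. by move=> x; ring. Qed.
Lemma Cmul0l : left_zero C0 Cmul. Proof. by move=> x; ring. Qed.
Lemma Cmul0r : right_zero C0 Cmul. Proof. by move=> x; ring. Qed.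
Lemma CmulDl : left_distributive Cmul Cadd. Proof. by move=> x y z; ring. Qed.
Lemma CmulDr : right_distributive Cmul Cadd. Proof. by move=> x y z; ring. Qed.

HB.instance Definition _ := Monoid.isComLaw.Build Cplx C0 Cadd CaddA CaddC Cadd0.
HB.instance Definition _ := Monoid.isComLaw.Build Cplx C1 Cmul CmulA CmulC Cmul1.
HB.instance Definition _ := Monoid.isMulLaw.Build Cplx C0 Cmul Cmul0l Cmul0r.
HB.instance Definition _ := Monoid.isAddLaw.Build Cplx Cmul Cadd CmulDl CmulDr.

Lemma Cmul_eq0 (x y : Cplx) : (x * y = 0)%C -> x = C0 \/ y = C0.
Proof.
case: x => a b; case: y => c d E.
have H1 := f_equal Re E; have H2 := f_equal Im E; rewrite /= in H1 H2.
case: (Req_dec (a * a + b * b) 0) => [ab|ab].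
  by left; apply: Cplx_eq => /=; nra.
right; apply: Cplx_eq => /=; apply: (Rmult_eq_reg_l (a * a + b * b)) => //.
  have -> : (a * a + b * b) * c = a * (a * c - b * d) + b * (a * d + b * c) by ring.
  by rewrite H1 H2; ring.
have -> : (a * a + b * b) * d = a * (a * d + b * c) - b * (a * c - b * d) by ring.
by rewrite H1 H2; ring.
Qed.

Lemma Csub_eq0 (x y : Cplx) : (x - y = 0)%C -> x = y.
Proof.
move=> H; have -> : x = (x - y + y)%C by ring.
by rewrite H; ring.
Qed.

Lemma CsumE (T : Type) (s : seq T) (F : T -> Cplx) : Csum s F = (\sum_(x <- s) F x)%C.
Proof. by elim: s => [|x s IH]; rewrite ?big_nil // big_cons -IH. Qed.

Lemma CprodE (T : Type) (s : seq T) (F : T -> Cplx) : Cprod s F = \big[Cmul/C1]_(x <- s) F x.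
Proof. by elim: s => [|x s IH]; rewrite ?big_nil // big_cons -IH. Qed.

Lemma derivable_pt_lim_shift (g : R -> R) (x l : R) :
  derivable_pt_lim (fun h => g (x + h)) 0 l <-> derivable_pt_lim g x l.
Proof.
by split=> H e e0; have [d Hd] := H e e0; exists d => h h0 hd; have := Hd h h0 hd;
  rewrite Rplus_0_l Rplus_0_r.
Qed.

Lemma derivable_pt_lim_affine (g : R -> R) (a b l : R) : derivable_pt_lim g a l ->
  derivable_pt_lim (fun s => g (a + b * s)) 0 (b * l).
Proof.
move=> dg; rewrite Rmult_comm.
apply: (derivable_pt_lim_comp (fun s => a + b * s) g); last by rewrite Rmult_0_r Rplus_0_r.
have := derivable_pt_lim_plus _ _ _ _ _ (derivable_pt_lim_const a 0)
  (derivable_pt_lim_scal _ b _ _ (derivable_pt_lim_id 0)).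
by rewrite Rplus_0_l Rmult_1_r.
Qed.

(** * Partial derivatives and closure properties of smooth functions *)

Section Functions.
Variable n : nat.
Implicit Types (f g h : fn n) (x : pt n) (i j : 'I_n) (al be : mi n).

Definition f0 : fn n := fun _ => C0.
Definition fadd f g : fn n := fun x => (f x + g x)%C.
Definition fmul f g : fn n := fun x => (f x * g x)%C.
Definition fscal (c : Cplx) f : fn n := fun x => (c * f x)%C.
Definition fsum (T : Type) (s : seq T) (F : T -> fn n) : fn n := fun x => (\sum_(k <- s) F k x)%C.

Lemma upd0 x i : upd x i 0 = x.
Proof. by apply: functional_extensionality => j; rewrite /upd; case: eqP => // ->; rewrite Rplus_0_r. Qed.

Lemma updD x i s t : upd (upd x i s) i t = upd x i (s + t).
Proof.
by apply: functional_extensionality => j; rewrite /upd eqxx; case: eqP => // _; rewrite Rplus_assoc.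
Qed.

Lemma updC x i j s t : i != j -> upd (upd x i s) j t = upd (upd x j t) i s.
Proof.
move=> ij; apply: functional_extensionality => k; rewrite /upd (negbTE ij) (eq_sym j) (negbTE ij).
by case: (k =P j) => [->|//]; rewrite (eq_sym j) (negbTE ij).
Qed.

Lemma is_pd_uniq i f g h : is_pd i f g -> is_pd i f h -> g = h.
Proof.
move=> fg fh; apply: functional_extensionality => x.
have [a b] := fg x; have [c d] := fh x.
by apply: Cplx_eq; [apply: uniqueness_limite a c | apply: uniqueness_limite b d].
Qed.

Lemma is_pd_pd i f g : is_pd i f g -> is_pd i f (pd i f).
Proof. by move=> fg; apply: (epsilon_spec (inhabits (fun _ => C0)) (is_pd i f)); exists g. Qed.

Lemma pdE i f g : is_pd i f g -> pd i f = g.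
Proof. by move=> fg; apply: (is_pd_uniq (is_pd_pd fg) fg). Qed.

Lemma is_pd_add i f g f' g' : is_pd i f f' -> is_pd i g g' -> is_pd i (fadd f g) (fadd f' g').
Proof. by move=> df dg x; have [a b] := df x; have [c d] := dg x; split; apply: derivable_pt_lim_plus. Qed.

Lemma is_pd_mul i f g f' g' : is_pd i f f' -> is_pd i g g' ->
  is_pd i (fmul f g) (fadd (fmul f' g) (fmul f g')).
Proof.
move=> df dg x; have [a b] := df x; have [c d] := dg x.
split.
  have := derivable_pt_lim_minus _ _ _ _ _ (derivable_pt_lim_mult _ _ _ _ _ a c)
    (derivable_pt_lim_mult _ _ _ _ _ b d).
  rewrite upd0 /=; congr derivable_pt_lim; ring.
have := derivable_pt_lim_plus _ _ _ _ _ (derivable_pt_lim_mult _ _ _ _ _ a d)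
  (derivable_pt_lim_mult _ _ _ _ _ b c).
rewrite upd0 /=; congr derivable_pt_lim; ring.
Qed.

Lemma is_pd_const i (c : Cplx) : is_pd i (fun _ => c) f0.
Proof. by move=> x; split; apply: derivable_pt_lim_const. Qed.

Lemma fscalE c f : fscal c f = fmul (fun _ => c) f.
Proof. by []. Qed.

Lemma is_pd_scal i c f f' : is_pd i f f' -> is_pd i (fscal c f) (fscal c f').
Proof.
move=> df; have := is_pd_mul (is_pd_const i c) df; rewrite fscalE; congr is_pd.
by apply: functional_extensionality => x; rewrite /fadd /fmul /f0 /fscal; ring.
Qed.

Lemma mono_split i al x :
  mono al x = (RC (x i ^ al i) * \big[Cmul/C1]_(j | j != i) RC (x j ^ al j))%C.
Proof. by rewrite /mono CprodE big_enum (bigD1 i). Qed.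

(** For [al i = 0] the truncated predecessor in [decr] leaves the monomial as it is, but the
    coefficient [INR (al i)] is zero. *)
Lemma is_pd_mono i al : is_pd i (mono al) (fscal (RC (INR (al i))) (mono (decr i al))).
Proof.
move=> x; rewrite /fscal (mono_split i) /decr eqxx.
have -> : \big[Cmul/C1]_(j | j != i) RC (x j ^ (if j == i then (al j).-1 else al j)) =
    \big[Cmul/C1]_(j | j != i) RC (x j ^ al j) by apply: eq_bigr => j /negbTE ->.
set Q := \big[Cmul/C1]_(_ | _) _.
have E s : mono al (upd x i s) = (RC ((x i + s) ^ al i) * Q)%C.
  rewrite (mono_split i) /upd eqxx; congr Cmul.
  by apply: eq_bigr => j /negbTE ->.
have D := proj2 (derivable_pt_lim_shift _ _ _) (derivable_pt_lim_pow (x i) (al i)).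
split.
  have -> : (fun s => Re (mono al (upd x i s))) = (fun s => Re Q * (x i + s) ^ al i).
    by apply: functional_extensionality => s; rewrite E /=; ring.
  have := derivable_pt_lim_scal _ (Re Q) _ _ D; congr derivable_pt_lim => /=; ring.
have -> : (fun s => Im (mono al (upd x i s))) = (fun s => Im Q * (x i + s) ^ al i).
  by apply: functional_extensionality => s; rewrite E /=; ring.
have := derivable_pt_lim_scal _ (Im Q) _ _ D; congr derivable_pt_lim => /=; ring.
Qed.

Lemma Rsum_upd (c : 'I_n -> R) x i t :
  Rsum (enum 'I_n) (fun j => c j * upd x i t j) = Rsum (enum 'I_n) (fun j => c j * x j) + c i * t.
Proof.
have : i \in enum 'I_n by rewrite mem_enum.
have := enum_uniq 'I_n; move: (enum 'I_n) => s.
suff H : uniq s -> Rsum s (fun j => c j * upd x i t j) =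
    Rsum s (fun j => c j * x j) + (if i \in s then c i * t else 0).
  by move=> us si; rewrite H // si.
elim: s => [|k s IH] /= => [_|/andP [ks us]]; first by rewrite Rplus_0_l.
rewrite IH // inE /upd; case: eqP => [ki|/nesym/eqP/negbTE ->]; last by rewrite /= Rplus_assoc.
by rewrite -ki eqxx (negbTE ks) /= Rplus_0_r Rmult_plus_distr_l !Rplus_assoc (Rplus_comm (c k * t)).
Qed.

Lemma is_pd_exp i lam : is_pd i (expC lam) (fscal (lam i) (expC lam)).
Proof.
move=> x; rewrite /fscal /expC /=.
set a := Rsum _ _; set b := Rsum _ _.
have Ea s : Rsum (enum 'I_n) (fun j => Re (lam j) * upd x i s j) = a + Re (lam i) * s by rewrite Rsum_upd.
have Eb s : Rsum (enum 'I_n) (fun j => Im (lam j) * upd x i s j) = b + Im (lam i) * s by rewrite Rsum_upd.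
have de := derivable_pt_lim_affine (Re (lam i)) (derivable_pt_lim_exp a).
have dc := derivable_pt_lim_affine (Im (lam i)) (derivable_pt_lim_cos b).
have ds := derivable_pt_lim_affine (Im (lam i)) (derivable_pt_lim_sin b).
split.
  have := derivable_pt_lim_mult _ _ _ _ _ de dc; rewrite !Rmult_0_r !Rplus_0_r /mult_fct.
  have -> : (fun s => exp (a + Re (lam i) * s) * cos (b + Im (lam i) * s)) =
    (fun s => exp (Rsum (enum 'I_n) (fun j => Re (lam j) * upd x i s j)) *
       cos (Rsum (enum 'I_n) (fun j => Im (lam j) * upd x i s j))).
    by apply: functional_extensionality => s; rewrite Ea Eb.
  by congr derivable_pt_lim; ring.
have := derivable_pt_lim_mult _ _ _ _ _ de ds; rewrite !Rmult_0_r !Rplus_0_r /mult_fct.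
have -> : (fun s => exp (a + Re (lam i) * s) * sin (b + Im (lam i) * s)) =
  (fun s => exp (Rsum (enum 'I_n) (fun j => Re (lam j) * upd x i s j)) *
     sin (Rsum (enum 'I_n) (fun j => Im (lam j) * upd x i s j))).
  by apply: functional_extensionality => s; rewrite Ea Eb.
by congr derivable_pt_lim; ring.
Qed.

Lemma Cinf_is_pd i f : Cinf f -> is_pd i f (pd i f).
Proof. by move=> /(_ [:: i]) [[g fg] _]; apply: is_pd_pd fg. Qed.

Lemma Cinf_pd i f : Cinf f -> Cinf (pd i f).
Proof. by move=> Cf ls; case: (Cf (i :: ls)). Qed.

Lemma pd_add i f g : Cinf f -> Cinf g -> pd i (fadd f g) = fadd (pd i f) (pd i g).
Proof. by move=> Cf Cg; apply: pdE; apply: is_pd_add; apply: Cinf_is_pd. Qed.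

Lemma pd_scal i c f : Cinf f -> pd i (fscal c f) = fscal c (pd i f).
Proof. by move=> Cf; apply: pdE; apply: is_pd_scal; apply: Cinf_is_pd. Qed.

Lemma Cinf_add f g : Cinf f -> Cinf g -> Cinf (fadd f g).
Proof.
move=> Cf Cg ls; elim: ls f g Cf Cg => //= i ls IH f g Cf Cg; split.
  by exists (fadd (pd i f) (pd i g)); apply: is_pd_add; apply: Cinf_is_pd.
by rewrite pd_add //; apply: IH; apply: Cinf_pd.
Qed.

Lemma Cinf_mul f g : Cinf f -> Cinf g -> Cinf (fmul f g).
Proof.
suff H ls : forall f g, Cinf f -> Cinf g -> diff_along ls (fmul f g) by move=> Cf Cg ls; apply: H.
elim: ls => //= i ls IH {}f {}g Cf Cg.
have D := is_pd_mul (Cinf_is_pd i Cf) (Cinf_is_pd i Cg).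
split; first by eexists; exact: D.
rewrite (pdE D).
(* Smoothness of the two products is what is being proved, so additivity is established for a single
   list of directions instead of through [Cinf_add]. *)
have add l : forall u v, diff_along l u -> diff_along l v -> diff_along l (fadd u v).
  elim: l => //= k l IHl u v [[u' uu'] Du] [[v' vv'] Dv].
  have E := is_pd_add (is_pd_pd uu') (is_pd_pd vv').
  by split; [eexists; exact: E | rewrite (pdE E); apply: IHl].
by apply: add; apply: IH => //; apply: Cinf_pd.
Qed.

Lemma Cinf_const c : Cinf (fun _ : pt n => c).
Proof.
suff H ls : forall c, diff_along ls (fun _ : pt n => c) by move=> ls; apply: H.
elim: ls => //= i ls IH {}c; split; first by eexists; apply: is_pd_const.
by rewrite (pdE (is_pd_const i c)); apply: IH.
Qed.

Lemma Cinf_scal c f : Cinf f -> Cinf (fscal c f).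
Proof. by move=> Cf; rewrite fscalE; apply: Cinf_mul => //; apply: Cinf_const. Qed.

Lemma Cinf_mono al : Cinf (mono al).
Proof.
(* Generalizing over the exponent and a scalar factor makes the family stable under every [pd i]. *)
suff H ls : forall al c, diff_along ls (fscal c (mono al)).
  move=> ls; have := H ls al C1; congr diff_along.
  by apply: functional_extensionality => x; rewrite /fscal; ring.
elim: ls => //= i ls IH {}al c.
have D := is_pd_scal c (is_pd_mono i al).
split; first by eexists; exact: D.
rewrite (pdE D).
have -> : fscal c (fscal (RC (INR (al i))) (mono (decr i al))) =
    fscal (c * RC (INR (al i)))%C (mono (decr i al)).
  by apply: functional_extensionality => x; rewrite /fscal; ring.
exact: IH.
Qed.

Lemma Cinf_exp lam : Cinf (expC lam : fn n).
Proof.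
suff H ls : forall c, diff_along ls (fscal c (expC lam : fn n)).
  move=> ls; have := H ls C1; congr diff_along.
  by apply: functional_extensionality => x; rewrite /fscal; ring.
elim: ls => //= i ls IH c.
have D := is_pd_scal c (is_pd_exp i lam).
split; first by eexists; exact: D.
rewrite (pdE D).
have -> : fscal c (fscal (lam i) (expC lam)) = fscal (c * lam i)%C (expC lam : fn n).
  by apply: functional_extensionality => x; rewrite /fscal; ring.
exact: IH.
Qed.

Lemma Cinf_sum (T : Type) (s : seq T) (F : T -> fn n) : (forall k, Cinf (F k)) -> Cinf (fsum s F).
Proof.
move=> CF; elim: s => [|k s IH].
  have -> : fsum [::] F = f0 by apply: functional_extensionality => x; rewrite /fsum big_nil.
  exact: Cinf_const.
have -> : fsum (k :: s) F = fadd (F k) (fsum s F).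
  by apply: functional_extensionality => x; rewrite /fsum /fadd big_cons.
exact: Cinf_add.
Qed.

(* [Cinf] only asks for iterated partial derivatives, which does not give joint continuity, so
   Schwarz's theorem does not apply and separate continuity has to suffice. *)
Lemma pd_comm i j f : Cinf f -> pd i (pd j f) = pd j (pd i f).
Proof.
move=> Cf; case: (eqVneq i j) => [->//|ij].
apply: functional_extensionality => x.
have shift (p : Cplx -> R) g k (y : pt n) s l :
    derivable_pt_lim (fun r => p (g (upd (upd y k s) k r))) 0 l ->
    derivable_pt_lim (fun r => p (g (upd y k r))) s l.
  move=> H; apply/(derivable_pt_lim_shift (fun r => p (g (upd y k r)))).
  have -> : (fun r => p (g (upd y k (s + r)))) = (fun r => p (g (upd (upd y k s) k r))) => //.
  by apply: functional_extensionality => r; rewrite updD.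
(* [p] stands for [Re] or [Im]. What is compared is a real function of the increments [a] and [b] in
   the directions [i] and [j], at (0, 0). *)
have key (p : Cplx -> R) :
    (forall k g y, Cinf g -> derivable_pt_lim (fun r => p (g (upd y k r))) 0 (p (pd k g y))) ->
    p (pd i (pd j f) x) = p (pd j (pd i f) x).
  move=> Hp.
  have Di g a b : Cinf g -> derivable_pt_lim (fun s => p (g (upd (upd x j b) i s))) a
      (p (pd i g (upd (upd x j b) i a))).
    by move=> Cg; apply: (shift p g i (upd x j b)); apply: Hp.
  have Dj g a b : Cinf g -> derivable_pt_lim (fun t => p (g (upd (upd x j t) i a))) b
      (p (pd j g (upd (upd x j b) i a))).
    move=> Cg; rewrite updC 1?eq_sym //.
    have -> : (fun t => p (g (upd (upd x j t) i a))) = (fun t => p (g (upd (upd x i a) j t))).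
      by apply: functional_extensionality => t; rewrite updC // eq_sym.
    by apply: (shift p g j (upd x i a)); apply: Hp.
  have ct (u : R -> R) a l : derivable_pt_lim u a l -> continuity_pt u a.
    by move=> D; apply: derivable_continuous_pt; exists l.
  have Ci := Cinf_pd i Cf; have Cj := Cinf_pd j Cf.
  have := @mixed_partials (fun a b => p (f (upd (upd x j b) i a)))
    (fun a b => p (pd i f (upd (upd x j b) i a))) (fun a b => p (pd j f (upd (upd x j b) i a)))
    (fun a b => p (pd j (pd i f) (upd (upd x j b) i a)))
    (fun a b => p (pd i (pd j f) (upd (upd x j b) i a))) _ _ _ _ _ _ _ 0 0.
  rewrite !upd0 => -> //; move=> a b; try by [apply: Di | apply: Dj].
  - by apply: ct; apply: (Di _ a b); apply: Cinf_pd.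
  - by apply: ct; apply: (Dj _ a b); apply: Cinf_pd.
  - by apply: ct; apply: (Di _ a b); apply: Cinf_pd.
by apply: Cplx_eq; apply: key => k g y Cg; case: (Cinf_is_pd k Cg y).
Qed.

End Functions.

(** * The action of the Weyl algebra *)

Section Pairing.
Variable T : Type.
Implicit Types (w : T -> Cplx) (a b : seq (Cplx * T)).

(** The linear extension of a weight on the index set. Coefficients, values of the action at a point
    and polynomial evaluation all have this form. *)
Definition lin w a : Cplx := (\sum_(m <- a) m.1 * w m.2)%C.

Lemma lin_cons w m a : lin w (m :: a) = (m.1 * w m.2 + lin w a)%C.
Proof. by rewrite /lin big_cons. Qed.

(** Collecting terms with equal index shows that a functional sees the coefficients only. The keys
    [e] provide the decidable equality that the index type [T] lacks. *)
Lemma lin_coef (K : eqType) (e : T -> K) (d : K -> T) w a (S : seq K) : cancel e d ->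
  uniq S -> {subset [seq e m.2 | m <- a] <= S} ->
  lin w a = (\sum_(k <- S) lin (fun t => if e t == k then C1 else C0) a * w (d k))%C.
Proof.
move=> ed uS; elim: a => [|m a IH] aS.
  by rewrite /lin big_nil big1_seq // => k _; rewrite big_nil; ring.
rewrite lin_cons IH => [|k ka]; last by apply: aS; rewrite inE ka orbT.
under [in RHS]eq_bigr => k _ do rewrite lin_cons CmulDl.
rewrite big_split /=; congr Cadd.
rewrite (bigD1_seq (e m.2)) //=; last by apply: aS; rewrite inE eqxx.
rewrite eqxx ed big1 => [|k kS]; first by ring.
by rewrite eq_sym (negbTE kS); ring.
Qed.

End Pairing.

Lemma fsum_nil n (T : Type) (F : T -> fn n) : fsum [::] F = @f0 n.
Proof. by apply: functional_extensionality => x; rewrite /fsum big_nil. Qed.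

Lemma fsum_cons n (T : Type) (k : T) s (F : T -> fn n) : fsum (k :: s) F = fadd (F k) (fsum s F).
Proof. by apply: functional_extensionality => x; rewrite /fsum big_cons. Qed.

Section Action.
Variable n : nat.
Implicit Types (f g q : fn n) (x : pt n) (i j : 'I_n) (al be : mi n) (a b : weyl n).

Lemma mieqP al be : reflect (al = be) (mieq al be).
Proof.
apply: (iffP forallP) => [H|-> i //].
by apply: functional_extensionality => i; apply/eqP.
Qed.

Definition mi_key al : {ffun 'I_n -> nat} := [ffun i => al i].
Definition key_mi (k : {ffun 'I_n -> nat}) : mi n := k.

Lemma mi_keyK : cancel mi_key key_mi.
Proof. by move=> al; apply: functional_extensionality => i; rewrite /key_mi ffunE. Qed.

Lemma key_miK : cancel key_mi mi_key.
Proof. by move=> k; apply/ffunP => i; rewrite ffunE. Qed.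

Lemma mi_key_eq al k : (mi_key al == k) = mieq al (key_mi k).
Proof. by apply/eqP/mieqP => [<-|->]; rewrite ?mi_keyK ?key_miK. Qed.

Lemma coefE a al be : coef a al be =
  lin (fun k => if mieq k.1 al && mieq k.2 be then C1 else C0) a.
Proof.
rewrite /coef CsumE /lin; apply: eq_bigr => m _.
by case: ifP => _; ring.
Qed.

(** This makes the action well defined on elements of [W_n], that is, on lists up to [weq]. *)
Lemma weq_lin a b (w : mi n * mi n -> Cplx) : weq a b -> lin w a = lin w b.
Proof.
move=> ab.
pose e (k : mi n * mi n) := (mi_key k.1, mi_key k.2).
pose d k := (key_mi k.1, key_mi k.2).
have ed : cancel e d by case=> al be; rewrite /e /d /= !mi_keyK.
pose S := undup ([seq e m.2 | m <- a] ++ [seq e m.2 | m <- b]).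
rewrite (@lin_coef _ _ e d w a S) ?undup_uniq //; last by move=> k ka; rewrite mem_undup mem_cat ka.
rewrite (@lin_coef _ _ e d w b S) ?undup_uniq //; last by move=> k ka; rewrite mem_undup mem_cat ka orbT.
apply: eq_bigr => -[k l] _; congr (_ * _)%C.
have E c : lin (fun t => if e t == (k, l) then C1 else C0) c = coef c (key_mi k) (key_mi l).
  rewrite coefE; congr lin; apply: functional_extensionality => -[al be] /=.
  by rewrite -!mi_key_eq.
by rewrite !E.
Qed.

Lemma actE a f x : act a f x = lin (fun k => mono k.1 x * dpow k.2 f x)%C a.
Proof. by rewrite /act CsumE. Qed.

Lemma weq_act a b f : weq a b -> act a f = act b f.
Proof. by move=> ab; apply: functional_extensionality => x; rewrite !actE (weq_lin _ ab). Qed.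

Lemma act_nil f : act [::] f = @f0 n.
Proof. by []. Qed.

Lemma act_cons m a f :
  act (m :: a) f = fadd (fscal m.1 (fmul (mono m.2.1) (dpow m.2.2 f))) (act a f).
Proof. by []. Qed.

Lemma act_cat a b f : act (a ++ b) f = fadd (act a f) (act b f).
Proof. by apply: functional_extensionality => x; rewrite /fadd !actE /lin big_cat. Qed.

Lemma act_flatten (T : Type) (s : seq T) (F : T -> weyl n) f :
  act (flatten (map F s)) f = fsum s (fun k => act (F k) f).
Proof.
apply: functional_extensionality => x; rewrite /fsum.
by elim: s => [|k s IH]; rewrite ?big_nil // big_cons /= act_cat /fadd IH.
Qed.

Lemma act_wscale c a f : act (wscale c a) f = fscal c (act a f).
Proof.
apply: functional_extensionality => x; rewrite /fscal !actE /lin big_map big_distrr /=.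
by apply: eq_bigr => m _; ring.
Qed.

Lemma Cinf_iter_pd i k f : Cinf f -> Cinf (iter k (pd i) f).
Proof. by move=> Cf; elim: k => //= k; apply: Cinf_pd. Qed.

Lemma pd_iter i j k f : Cinf f -> pd i (iter k (pd j) f) = iter k (pd j) (pd i f).
Proof. by move=> Cf; elim: k => //= k <-; rewrite pd_comm //; apply: Cinf_iter_pd. Qed.

Lemma Cinf_foldr_pd be f (s : seq 'I_n) : Cinf f -> Cinf (foldr (fun i g => iter (be i) (pd i) g) f s).
Proof. by move=> Cf; elim: s => //= i s; apply: Cinf_iter_pd. Qed.

Lemma Cinf_dpow be f : Cinf f -> Cinf (dpow be f).
Proof. exact: Cinf_foldr_pd. Qed.

(** Symmetry of mixed partials enters here: the outer [pd i] has to move inwards past the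
    derivatives that [dpow] applies after its own power of [pd i]. *)
Lemma dpow_incr i be f : Cinf f -> dpow (incr i be) f = pd i (dpow be f).
Proof.
move=> Cf; have : i \in enum 'I_n by rewrite mem_enum.
rewrite /dpow; have := enum_uniq 'I_n; move: (enum 'I_n) => s us si.
suff -> : foldr (fun k g => iter (incr i be k) (pd k) g) f s =
    (if i \in s then pd i else id) (foldr (fun k g => iter (be k) (pd k) g) f s) by rewrite si.
elim: s us {si} => //= k s IH /andP [ks us]; rewrite (IH us) inE /incr [i == k]eq_sym.
case: eqP => [ki|_] /=; first by rewrite -ki (negbTE ks).
by case: (i \in s) => //; rewrite pd_iter //; apply: Cinf_foldr_pd.
Qed.

Lemma dpow0 f : dpow (@mi0 n) f = f.
Proof. by rewrite /dpow; elim: (enum _) => //= i s ->. Qed.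

Lemma mono0 x : mono (@mi0 n) x = C1.
Proof. by rewrite /mono CprodE big1. Qed.

Lemma mono_incr i al x : mono (incr i al) x = (RC (x i) * mono al x)%C.
Proof.
rewrite !(mono_split i) /incr eqxx /=.
have -> : \big[Cmul/C1]_(j | j != i) RC (x j ^ (if j == i then (al j).+1 else al j)) =
    \big[Cmul/C1]_(j | j != i) RC (x j ^ al j) by apply: eq_bigr => j /negbTE ->.
by apply: Cplx_eq => /=; ring.
Qed.

Lemma Cinf_act a f : Cinf f -> Cinf (act a f).
Proof.
move=> Cf; elim: a => [|m a IH]; first exact: Cinf_const.
rewrite act_cons; apply: Cinf_add => //; apply: Cinf_scal; apply: Cinf_mul.
  exact: Cinf_mono.
exact: Cinf_dpow.
Qed.

Lemma act_f0 a : act a (@f0 n) = @f0 n.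
Proof.
have p0 i : pd i (@f0 n) = @f0 n by apply: pdE; apply: is_pd_const.
apply: functional_extensionality => x; rewrite actE /lin big1 // => m _.
have -> : dpow m.2.2 (@f0 n) = @f0 n by rewrite /dpow; elim: (enum _) => //= i s ->; elim: (m.2.2 i) => //= k ->.
by rewrite /f0; ring.
Qed.

Lemma act_add a f g : Cinf f -> Cinf g -> act a (fadd f g) = fadd (act a f) (act a g).
Proof.
move=> Cf Cg; apply: functional_extensionality => x; rewrite /fadd !actE /lin -big_split /=.
apply: eq_bigr => m _; rewrite -CmulDr -CmulDr; congr (_ * (_ * _))%C.
suff -> : dpow m.2.2 (fadd f g) = fadd (dpow m.2.2 f) (dpow m.2.2 g) by [].
rewrite /dpow; elim: (enum _) => //= i s ->.
by elim: (m.2.2 i) => //= k ->; rewrite pd_add //; apply: Cinf_iter_pd; apply: Cinf_foldr_pd.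
Qed.

Lemma act_sum a (T : Type) (s : seq T) (F : T -> fn n) x : (forall k, Cinf (F k)) ->
  act a (fsum s F) x = (\sum_(k <- s) act a (F k) x)%C.
Proof.
move=> CF; elim: s => [|k s IH]; first by rewrite fsum_nil act_f0 big_nil.
by rewrite fsum_cons act_add ?big_cons -?IH //; apply: Cinf_sum.
Qed.

Lemma act_tmul i a f : act (tmul i a) f = fmul (fun x => RC (x i)) (act a f).
Proof.
apply: functional_extensionality => x; rewrite /fmul !actE /lin big_map big_distrr /=.
by apply: eq_bigr => m _; rewrite mono_incr; ring.
Qed.

(** The product rule on t^al times a derivative of [f] gives exactly the two terms by which [dmul]
    restores normal order. *)
Lemma act_dmul i a f : Cinf f -> act (dmul i a) f = pd i (act a f).
Proof.
move=> Cf; elim: a => [|m a IH]; first by rewrite act_nil (pdE (is_pd_const i C0)).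
have Cm : Cinf (fmul (mono m.2.1) (dpow m.2.2 f)).
  by apply: Cinf_mul; [apply: Cinf_mono | apply: Cinf_dpow].
rewrite act_cons pd_add; [|exact: Cinf_scal|exact: Cinf_act].
rewrite pd_scal // -IH (pdE (is_pd_mul (is_pd_mono i _) (Cinf_is_pd i (Cinf_dpow _ Cf)))) -dpow_incr //.
have -> : dmul i (m :: a) = (m.1, (m.2.1, incr i m.2.2)) ::
  (RC (INR (m.2.1 i)) * m.1, (decr i m.2.1, m.2.2))%C :: dmul i a by [].
rewrite !act_cons /=; apply: functional_extensionality => x.
by rewrite /fadd /fscal /fmul; ring.
Qed.

Lemma act_tpow al a f : act (tpow al a) f = fmul (mono al) (act a f).
Proof.
apply: functional_extensionality => x; rewrite /fmul /tpow /mono.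
elim: (enum _) => [|i s IH] /=; first by ring.
rewrite -CmulA -IH; elim: (al i) => [|k IHk] /=; first by apply: Cplx_eq => /=; ring.
by rewrite act_tmul /fmul IHk; apply: Cplx_eq => /=; ring.
Qed.

Lemma act_dpoww be a f : Cinf f -> act (dpoww be a) f = dpow be (act a f).
Proof.
move=> Cf; rewrite /dpoww /dpow; elim: (enum _) => //= i s <-.
by elim: (be i) => //= k <-; rewrite act_dmul.
Qed.

(** The module law, reduced term by term to left multiplication by the generators t_i and d_i. *)
Lemma act_wmul a b f : Cinf f -> act (wmul a b) f = act a (act b f).
Proof.
move=> Cf; have Cb := Cinf_act b Cf.
rewrite /wmul act_flatten; apply: functional_extensionality => x.
rewrite /fsum actE /lin; apply: eq_bigr => m _.
rewrite act_tpow act_dpoww // act_wscale /fmul.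
suff -> : dpow m.2.2 (fscal m.1 (act b f)) = fscal m.1 (dpow m.2.2 (act b f)) by rewrite /fscal; ring.
rewrite /dpow; elim: (enum _) => //= i s ->.
have C s' := Cinf_foldr_pd m.2.2 s' Cb.
by elim: (m.2.2 i) => //= k ->; rewrite pd_scal //; apply: Cinf_iter_pd.
Qed.

(* Multiplication by exp_lam intertwines d_i - lam_i with d_i. *)
Lemma act_sigma lam a q : Cinf q ->
  act (sigma lam a) (fmul q (expC lam)) = fmul (act a q) (expC lam).
Proof.
move=> Cq; have CE := Cinf_mul Cq (Cinf_exp lam).
rewrite /sigma act_flatten; apply: functional_extensionality => x.
rewrite {2}/fmul /fsum actE /lin big_distrl /=; apply: eq_bigr => m _; rewrite act_tpow.
(* What remains is a word in the factors [d_i - lam i]. The product rule on [u] times exp_lam yields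
   the derivative of [u] plus [lam i] times [u], and the shift cancels the latter. *)
set s := foldr _ _ _; suff -> : act s (fmul q (expC lam)) = fscal m.1 (fmul (dpow m.2.2 q) (expC lam)).
  have AC (u v w z : Cplx) : (u * (v * (w * z)) = v * (u * w) * z)%C by ring.
  by rewrite /fmul /fscal AC.
rewrite {}/s /dpow; elim: (enum _) => [|i s IH] /=.
  rewrite act_cons act_nil dpow0; apply: functional_extensionality => y.
  by rewrite /fadd /fscal /fmul /f0 mono0 /=; ring.
have C := Cinf_foldr_pd m.2.2 s Cq.
elim: (m.2.2 i) => //= k; set y := iter _ _ _; set u := iter _ _ _ => IHk.
have Cu : Cinf u by apply: Cinf_iter_pd.
rewrite act_cat act_wscale act_dmul // IHk pd_scal; last by apply: Cinf_mul => //; apply: Cinf_exp.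
rewrite (pdE (is_pd_mul (Cinf_is_pd i Cu) (is_pd_exp i lam))).
by apply: functional_extensionality => z; rewrite /fadd /fscal /fmul; ring.
Qed.

(** Used in two ways: exponentials have no zeros, and multiplication by one is undone by
    multiplication by another. *)
Lemma expCN lam x : (expC lam x * expC (fun i => - lam i) x = 1)%C.
Proof.
have N (h : Cplx -> R) : (forall c, h (- c)%C = - h c) ->
    Rsum (enum 'I_n) (fun i => h (- lam i)%C * x i) = - Rsum (enum 'I_n) (fun i => h (lam i) * x i).
  move=> hN; elim: (enum _) => [|i s IH] /=; first by rewrite Ropp_0.
  by rewrite IH hN Ropp_plus_distr Ropp_mult_distr_l.
rewrite /expC (N Re) // (N Im) // exp_Ropp cos_neg sin_neg.
set a := exp _; set b := Rsum _ _.
have a0 : a <> 0 by apply: Rgt_not_eq; apply: exp_pos.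
have := sin2_cos2 b; rewrite /Rsqr => sc.
apply: Cplx_eq => /=; field_simplify => //.
by rewrite -sc; ring.
Qed.

End Action.

Lemma fadd0 n (f : fn n) : fadd f (@f0 n) = f.
Proof. by apply: functional_extensionality => x; rewrite /fadd /f0; ring. Qed.

(** * Linear independence and faithfulness *)

(* Generalized eigenspaces, for distinct joint eigenvalues, of the operators [L i] are independent. *)
Section Eigenspaces.
Variables (n : nat) (G : ('I_n -> Cplx) -> fn n -> Prop) (L : 'I_n -> fn n -> fn n).

Definition opsub i (c : Cplx) (f : fn n) : fn n := fadd (L i f) (fscal (- c)%C f).

Hypothesis G_Cinf : forall mu f, G mu f -> Cinf f.
Hypothesis L_add : forall i f g, Cinf f -> Cinf g -> L i (fadd f g) = fadd (L i f) (L i g).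
Hypothesis L_scal : forall i c f, Cinf f -> L i (fscal c f) = fscal c (L i f).
Hypothesis G_stable : forall mu i c f, G mu f -> G mu (opsub i c f).
Hypothesis G_nilpotent : forall mu i f, G mu f -> exists N, iter N (opsub i (mu i)) f = @f0 n.

Lemma L0 i : L i (@f0 n) = @f0 n.
Proof.
have E (f : fn n) : fscal 0%C f = @f0 n by apply: functional_extensionality => x; rewrite /fscal /f0; ring.
by rewrite -{1}(E (@f0 n)) L_scal ?E //; apply: Cinf_const.
Qed.

Lemma G_iter mu i c N f : G mu f -> G mu (iter N (opsub i c) f).
Proof. by move=> Gf; elim: N => //= N; apply: G_stable. Qed.

(** A vector killed by [L i - c] is an eigenvector, on which [L i - mu i] is multiplication by the
    nonzero scalar [c - mu i]; nilpotency then forces it to vanish. *)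
Lemma opsub_inj mu i c f : G mu f -> c <> mu i -> opsub i c f = @f0 n -> f = @f0 n.
Proof.
move=> Gf cm fc0; have Cf := G_Cinf Gf.
have Lf : L i f = fscal c f.
  apply: functional_extensionality => x; have := f_equal (@^~ x) fc0.
  rewrite /opsub /fadd /fscal /f0 => H; apply: Csub_eq0; rewrite -H; ring.
have step d : opsub i (mu i) (fscal d f) = fscal (d * (c - mu i))%C f.
  rewrite /opsub L_scal // Lf; apply: functional_extensionality => x.
  by rewrite /fadd /fscal; ring.
have [N] := G_nilpotent i Gf.
suff [d d0 ->] : exists2 d, d <> C0 & iter N (opsub i (mu i)) f = fscal d f.
  move=> H; apply: functional_extensionality => x.
  by case: (Cmul_eq0 (f_equal (@^~ x) H)).
elim: N => [|N [d d0 IH]] /=.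
  exists C1; first by case=> /R1_neq_R0.
  by apply: functional_extensionality => x; rewrite /fscal; ring.
exists (d * (c - mu i))%C; last by rewrite IH step.
by case/Cmul_eq0 => // /Csub_eq0.
Qed.

Lemma opsub_iter_inj mu i c N f : G mu f -> c <> mu i -> iter N (opsub i c) f = @f0 n -> f = @f0 n.
Proof.
move=> Gf cm; elim: N => //= N IH H; apply: IH.
exact: (opsub_inj (G_iter i c N Gf) cm).
Qed.

Lemma opsub_sum (T : Type) (s : seq T) (F : T -> fn n) i c : (forall k, Cinf (F k)) ->
  opsub i c (fsum s F) = fsum s (fun k => opsub i c (F k)).
Proof.
move=> CF; elim: s => [|k s IH].
  rewrite !fsum_nil /opsub L0; apply: functional_extensionality => x.
  by rewrite /fadd /fscal /f0; ring.
rewrite !fsum_cons -IH /opsub L_add //; last exact: Cinf_sum.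
by apply: functional_extensionality => x; rewrite /fadd /fscal; ring.
Qed.

(** For [k] in the tail choose a coordinate [i] where [mu k] and [mu k0] differ. A power of
    [L i - mu k0 i] kills the head term and is injective on [G (mu k)], so the induction hypothesis
    for the transformed tail gives [F k = 0]. Since [i] depends on [k], this is done afresh for
    every [k]. *)
Lemma G_independent (T : eqType) (s : seq T) (mu : T -> 'I_n -> Cplx) (F : T -> fn n) :
  uniq s -> {in s &, injective mu} -> (forall k, G (mu k) (F k)) ->
  fsum s F = @f0 n -> forall k, k \in s -> F k = @f0 n.
Proof.
elim: s F => // k0 s IH F /andP [k0s us] inj GF sum0.
have s0 k : k \in s -> F k = @f0 n.
  move=> ks.
  have [i ki] : exists i, mu k0 i <> mu k i.
    apply: NNPP => H; case/negP: k0s.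
    have -> // : k0 = k.
    apply: inj; rewrite ?inE ?eqxx ?ks ?orbT //; apply: functional_extensionality => i.
    by apply: NNPP => H'; apply: H; exists i.
  have [N N0] := G_nilpotent i (GF k0).
  apply: (@opsub_iter_inj _ i (mu k0 i) N _ (GF k) ki).
  apply: (IH (fun k => iter N (opsub i (mu k0 i)) (F k))) => //.
  - by move=> a b sa sb; apply: inj; rewrite inE ?sa ?sb orbT.
  - by move=> l; apply: G_iter.
  have E M : iter M (opsub i (mu k0 i)) (fsum (k0 :: s) F) =
      fsum (k0 :: s) (fun k => iter M (opsub i (mu k0 i)) (F k)).
    elim: M => //= M ->; rewrite opsub_sum // => l.
    by apply: G_Cinf (G_iter i _ M (GF l)).
  have := E N; rewrite sum0 fsum_cons N0.
  have -> : iter N (opsub i (mu k0 i)) (@f0 n) = @f0 n.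
    elim: N {N0} => //= N ->; rewrite /opsub L0; apply: functional_extensionality => x.
    by rewrite /fadd /fscal /f0; ring.
  by move=> ->; apply: functional_extensionality => x; rewrite /fadd /f0; ring.
move=> k; rewrite inE => /orP [/eqP ->|]; last exact: s0.
move: sum0; rewrite fsum_cons.
suff -> : fsum s F = @f0 n by rewrite fadd0.
apply: functional_extensionality => x; rewrite /fsum big1_seq // => l /andP [_ ls].
by rewrite s0.
Qed.

End Eigenspaces.

(** * Independence of monomials and faithfulness of the action *)

Section Faithful.
Variable n : nat.
Implicit Types (p : mpoly n) (a b : weyl n).

(* The monomials are eigenvectors of the Euler operators t_i d_i. *)
Lemma mono_independent p : (forall x, lin (fun al => mono al x) p = C0) ->
  forall al, lin (fun be => if mieq be al then C1 else C0) p = C0.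
Proof.
move=> p0 al; pose c k := lin (fun t => if mi_key t == k then C1 else C0) p.
have -> : lin (fun be => if mieq be al then C1 else C0) p = c (mi_key al).
  congr lin; apply: functional_extensionality => be; by rewrite mi_key_eq mi_keyK.
(* Adding the key of [al] covers the case that this exponent does not occur in [p]. *)
pose S := undup (mi_key al :: [seq mi_key m.2 | m <- p]).
pose ev (al : mi n) i := RC (INR (al i)).
pose G (mu : 'I_n -> Cplx) f := exists c al, mu = ev al /\ f = fscal c (mono al).
pose L i (f : fn n) : fn n := fmul (fun x => RC (x i)) (pd i f).
have LG i d be : L i (fscal d (mono be)) = fscal (ev be i) (fscal d (mono be)).
  rewrite /L pd_scal; last exact: Cinf_mono.
  rewrite (pdE (is_pd_mono i be)) /ev; apply: functional_extensionality => x; rewrite /fmul /fscal.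
  case: (posnP (be i)) => [->|b0]; first by apply: Cplx_eq => /=; ring.
  have -> : mono be x = (RC (x i) * mono (decr i be) x)%C; last by ring.
  rewrite -mono_incr; congr mono; apply: functional_extensionality => j; rewrite /incr /decr.
  by case: eqP => // ->; rewrite prednK.
have opG i e mu f : G mu f -> opsub L i e f = fscal (mu i - e)%C f.
  case=> d [be [-> ->]]; rewrite /opsub LG; apply: functional_extensionality => x.
  by rewrite /fadd /fscal; ring.
have : fscal (c (mi_key al)) (mono (key_mi (mi_key al))) = @f0 n.
  apply: (@G_independent n G L _ _ _ _ _ _ S (fun k => ev (key_mi k)) (fun k => fscal (c k) (mono (key_mi k)))).
  - by move=> mu f [d [be [_ ->]]]; apply: Cinf_scal; apply: Cinf_mono.
  - move=> i f g Cf Cg; rewrite /L pd_add //; apply: functional_extensionality => x.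
    by rewrite /fmul /fadd; ring.
  - move=> i d f Cf; rewrite /L pd_scal //; apply: functional_extensionality => x.
    by rewrite /fmul /fscal; ring.
  - move=> mu i e f Gf; rewrite (opG _ _ _ _ Gf); case: Gf => d [be [-> ->]].
    exists ((ev be i - e) * d)%C, be; split=> //.
    by apply: functional_extensionality => x; rewrite /fscal; ring.
  - move=> mu i f Gf; exists 1%N; rewrite /= (opG _ _ _ _ Gf).
    by apply: functional_extensionality => x; rewrite /fscal /f0; ring.
  - exact: undup_uniq.
  - move=> k l _ _ E; apply/ffunP => i; apply: INR_eq.
    exact: (f_equal Re (f_equal (@^~ i) E)).
  - by move=> k; exists (c k), (key_mi k).
  - apply: functional_extensionality => x; transitivity (lin (fun be => mono be x) p); last exact: p0.
    rewrite (@lin_coef _ _ _ _ (fun be => mono be x) p S (@mi_keyK n) (undup_uniq _)) //.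
    by move=> k kp; rewrite mem_undup inE kp orbT.
  - by rewrite mem_undup inE eqxx.
(* At the point (1, ..., 1) every monomial is 1, which isolates the scalar. *)
move=> /(f_equal (@^~ (fun _ => 1))); rewrite /fscal /f0 mi_keyK.
have -> : mono al (fun _ => 1) = C1.
  by rewrite /mono CprodE big1 // => i _; rewrite pow1.
by move=> <-; ring.
Qed.

Lemma dpow_exp (lam : 'I_n -> Cplx) be :
  dpow be (expC lam : fn n) = fscal (Cprod (enum 'I_n) (fun i => iter (be i) (Cmul (lam i)) C1)) (expC lam).
Proof.
rewrite /dpow; elim: (enum _) => [|i s IH] /=.
  by apply: functional_extensionality => x; rewrite /fscal; ring.
rewrite IH; elim: (be i) => [|k IHk] /=.
  by apply: functional_extensionality => x; rewrite /fscal; ring.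
rewrite IHk pd_scal; last exact: Cinf_exp.
by rewrite (pdE (is_pd_exp i lam)); apply: functional_extensionality => x; rewrite /fscal; ring.
Qed.

(** The symbol of the difference vanishes identically, and independence of monomials is applied to
    it in [x] for fixed [l], then in [l]. *)
Lemma act_faithful a b : (forall lam, act a (expC lam) = act b (expC lam)) -> weq a b.
Proof.
move=> ab al be; apply: Csub_eq0; pose c := a ++ wscale (- (1))%C b.
have -> : (coef a al be - coef b al be = coef c al be)%C.
  rewrite !coefE /c /lin big_cat big_map /=; congr Cadd.
  transitivity (- (1) * lin (fun k => if mieq k.1 al && mieq k.2 be then C1 else C0) b)%C.
    by rewrite /lin; ring.
  by rewrite /lin big_distrr; apply: eq_bigr => m _ /=; ring.
have c0 x l : lin (fun k => mono k.1 x * mono k.2 l)%C c = C0.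
  (* Real exponents suffice: [mono_independent] evaluates at real points. *)
  pose lam i := RC (l i).
  have : act c (expC lam) x = C0.
    by rewrite act_cat act_wscale ab /fadd /fscal; ring.
  rewrite actE /lin.
  under eq_bigr => m _ do rewrite dpow_exp.
  rewrite (eq_bigr (fun m => m.1 * (mono m.2.1 x * mono m.2.2 l) * expC lam x)%C); last first.
    move=> m _; rewrite /fscal; set u := Cprod _ _; have -> : u = mono m.2.2 l; last by ring.
    rewrite /u /mono !CprodE; apply: eq_bigr => i _.
    by elim: (m.2.2 i) => //= k ->; apply: Cplx_eq => /=; ring.
  rewrite -big_distrl /= => /Cmul_eq0 [//|E]; have := expCN lam x.
  by rewrite E => /(f_equal Re) /=; lra.
have c1 l : lin (fun k => (if mieq k.1 al then C1 else C0) * mono k.2 l)%C c = C0.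
  have := @mono_independent [seq (m.1 * mono m.2.2 l, m.2.1)%C | m <- c].
  move=> /(_ _ al) E; rewrite -[RHS]E; last first.
    by move=> x; rewrite -[RHS](c0 x l) /lin big_map; apply: eq_bigr => m _ /=; rewrite -CmulA (CmulC (mono _ l)).
  by rewrite /lin big_map; apply: eq_bigr => m _ /=; rewrite -CmulA (CmulC (mono _ l)).
have := @mono_independent [seq (m.1 * if mieq m.2.1 al then C1 else C0, m.2.2)%C | m <- c].
move=> /(_ _ be) E; rewrite coefE -[RHS]E.
  by rewrite /lin big_map; apply: eq_bigr => m _ /=; case: mieq; case: mieq => /=; ring.
by move=> x; rewrite -[RHS](c1 x) /lin big_map; apply: eq_bigr => m _ /=; rewrite -CmulA.
Qed.

(** Write exp_lam as (exp_lam exp_{-mu}) exp_mu: the intertwinings for [mu] and for its negative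
    then cancel. *)
Lemma sigmaK (mu : 'I_n -> Cplx) a : weq a (sigma mu (sigma (fun i => - mu i)%C a)).
Proof.
apply: act_faithful => lam; have CE := Cinf_exp lam.
pose mu' i := (- mu i)%C.
have cancel_exp (f : fn n) : fmul (fmul f (expC mu')) (expC mu) = f.
  apply: functional_extensionality => x; rewrite /fmul -CmulA (CmulC (expC mu' x)) expCN; ring.
rewrite -[in RHS](cancel_exp (expC lam)) act_sigma; last by apply: Cinf_mul => //; apply: Cinf_exp.
by rewrite act_sigma // cancel_exp.
Qed.

End Faithful.

(** * Polynomial multiples of a fixed exponential *)

Section ExponentialPolynomials.
Variable n : nat.
Implicit Types (p : mpoly n) (f : fn n).

Definition exp_poly (mu : 'I_n -> Cplx) f := exists p, f = fmul (peval p) (expC mu).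

(** Terms free of t_i are dropped instead of kept with coefficient 0, so that every exponent of t_i
    left in the list has gone down by one and iteration ends at the empty list. *)
Definition pder i p : mpoly n :=
  [seq (RC (INR (m.2 i)) * m.1, decr i m.2)%C | m <- p & m.2 i != 0%N].

Lemma peval_cons (m : Cplx * mi n) p : peval (m :: p) = fadd (fscal m.1 (mono m.2)) (peval p).
Proof. by []. Qed.

Lemma is_pd_peval i p : is_pd i (peval p) (peval (pder i p)).
Proof.
elim: p => [|m p IH]; first exact: is_pd_const.
rewrite peval_cons; have := is_pd_add (is_pd_scal m.1 (is_pd_mono i m.2)) IH; congr is_pd.
have -> : pder i (m :: p) = if m.2 i == 0%N then pder i p
    else (RC (INR (m.2 i)) * m.1, decr i m.2)%C :: pder i p by rewrite /pder /=; case: eqP.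
apply: functional_extensionality => x; case: eqP => [E|_].
  by rewrite /fadd /fscal E; apply: Cplx_eq => /=; ring.
by rewrite peval_cons /fadd /fscal /=; ring.
Qed.

Lemma Cinf_peval p : Cinf (peval p).
Proof.
elim: p => [|m p IH]; first exact: Cinf_const.
by rewrite peval_cons; apply: Cinf_add => //; apply: Cinf_scal; apply: Cinf_mono.
Qed.

Lemma exp_poly_Cinf mu f : exp_poly mu f -> Cinf f.
Proof. by case=> p ->; apply: Cinf_mul; [apply: Cinf_peval | apply: Cinf_exp]. Qed.

Lemma exp_poly_add mu f g : exp_poly mu f -> exp_poly mu g -> exp_poly mu (fadd f g).
Proof.
case=> p -> [q ->]; exists (p ++ q); apply: functional_extensionality => x.
by rewrite /fadd /fmul /peval !CsumE big_cat /= CmulDl.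
Qed.

Lemma exp_poly_scal mu c f : exp_poly mu f -> exp_poly mu (fscal c f).
Proof.
case=> p ->; exists [seq (c * m.1, m.2)%C | m <- p]; apply: functional_extensionality => x.
rewrite /fscal /fmul /peval !CsumE big_map CmulA; congr Cmul; rewrite big_distrr.
by apply: eq_bigr => m _ /=; ring.
Qed.

Lemma exp_poly_mono mu al f : exp_poly mu f -> exp_poly mu (fmul (mono al) f).
Proof.
case=> p ->; exists [seq (m.1, fun i => al i + m.2 i)%N | m <- p]; apply: functional_extensionality => x.
rewrite /fmul /peval !CsumE big_map CmulA; congr Cmul; rewrite big_distrr.
apply: eq_bigr => m _ /=.
have -> : mono (fun i => al i + m.2 i)%N x = (mono al x * mono m.2 x)%C; last by rewrite !CmulA (CmulC m.1).
rewrite /mono !CprodE -big_split; apply: eq_bigr => i _ /=.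
by rewrite pow_add; apply: Cplx_eq => /=; ring.
Qed.

Lemma pd_peval_exp i mu p :
  pd i (fmul (peval p) (expC mu)) = fadd (fmul (peval (pder i p)) (expC mu)) (fscal (mu i) (fmul (peval p) (expC mu))).
Proof.
rewrite (pdE (is_pd_mul (is_pd_peval i p) (is_pd_exp i mu))).
by apply: functional_extensionality => x; rewrite /fadd /fmul /fscal; ring.
Qed.

Lemma exp_poly_pd i mu f : exp_poly mu f -> exp_poly mu (pd i f).
Proof.
case=> p ->; rewrite pd_peval_exp; apply: exp_poly_add; first by exists (pder i p).
by apply: exp_poly_scal; exists p.
Qed.

Lemma exp_poly0 mu : exp_poly mu (@f0 n).
Proof. by exists [::]; apply: functional_extensionality => x; rewrite /fmul /f0 /=; ring. Qed.

Lemma exp_poly_act mu a f : exp_poly mu f -> exp_poly mu (act a f).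
Proof.
move=> Ef; elim: a => [|m a IH]; first exact: exp_poly0.
rewrite act_cons; apply: exp_poly_add => //; apply: exp_poly_scal; apply: exp_poly_mono.
rewrite /dpow; elim: (enum _) => //= i s IHs.
by elim: (m.2.2 i) => //= k; apply: exp_poly_pd.
Qed.

Lemma exp_poly_sum mu (T : Type) (s : seq T) (F : T -> fn n) :
  (forall k, exp_poly mu (F k)) -> exp_poly mu (fsum s F).
Proof.
move=> EF; elim: s => [|k s IH]; first by rewrite fsum_nil; apply: exp_poly0.
by rewrite fsum_cons; apply: exp_poly_add.
Qed.

(** Since (d_i - mu_i)(p exp_mu) = (d_i p) exp_mu, any strict bound on the exponents of t_i in [p]
    serves as [N]. *)
Lemma exp_poly_nilpotent mu i f : exp_poly mu f ->
  exists N, iter N (opsub (@pd n) i (mu i)) f = @f0 n.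
Proof.
case=> p ->; have [N pN] : exists N, all (fun m => m.2 i < N)%N p.
  elim: p => [|m p [N pN]]; first by exists 0%N.
  exists (maxn N (m.2 i).+1) => /=; rewrite leq_max ltnSn orbT /=.
  by apply: sub_all pN => k kN; rewrite leq_max kN.
exists N; elim: N p pN => [|N IH] p pN.
  have -> : p = [::] by case: p pN.
  by apply: functional_extensionality => x; rewrite /fmul /f0 /=; ring.
rewrite iterSr; have -> : opsub (@pd n) i (mu i) (fmul (peval p) (expC mu)) = fmul (peval (pder i p)) (expC mu).
  by rewrite /opsub pd_peval_exp; apply: functional_extensionality => x; rewrite /fadd /fmul /fscal; ring.
apply: IH; rewrite all_map all_filter; apply: sub_all pN => m mN /=.
apply/implyP; rewrite /decr eqxx -lt0n => m0.
by rewrite -ltnS prednK.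
Qed.

Lemma exp_poly_independent (T : eqType) (s : seq T) (mu : T -> 'I_n -> Cplx) (F : T -> fn n) :
  uniq s -> {in s &, injective mu} -> (forall k, exp_poly (mu k) (F k)) ->
  fsum s F = @f0 n -> forall k, k \in s -> F k = @f0 n.
Proof.
apply: (@G_independent n exp_poly (@pd n)) => //.
- exact: exp_poly_Cinf.
- exact: pd_add.
- exact: pd_scal.
- move=> nu i c f Ef; apply: exp_poly_add; first exact: exp_poly_pd.
  exact: exp_poly_scal.
- exact: exp_poly_nilpotent.
Qed.

End ExponentialPolynomials.

(** * Decomposition of the kernel *)

Section Classes.
Variables (n m : nat) (lam : 'I_m -> 'I_n -> Cplx).
Implicit Types (j k : 'I_m) (K : {set 'I_m}).

Lemma in_cls j k : reflect (lam j = lam k) (j \in cls lam k).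
Proof. by rewrite inE /pbool; case: excluded_middle_informative => H; constructor. Qed.

Lemma cls_eq j k : j \in cls lam k -> cls lam k = cls lam j.
Proof.
move=> /in_cls jk; apply/setP => i.
by apply/in_cls/in_cls; rewrite jk.
Qed.

Lemma cls_in_classes k : cls lam k \in classes lam.
Proof. exact: imset_f. Qed.

Lemma mem_cls k : k \in cls lam k.
Proof. exact/in_cls. Qed.

Lemma class_of K k : K \in classes lam -> k \in K -> K = cls lam k.
Proof. by case/imsetP => i _ -> /cls_eq. Qed.

Lemma mu_class K k : K \in classes lam -> k \in K -> mu lam K = lam k.
Proof.
move=> KC kK; rewrite /mu; case E : (enum K) => [|j s].
  by move: kK; rewrite -mem_enum E.
have jK : j \in K by rewrite -mem_enum E inE eqxx.
by apply/in_cls; rewrite -(class_of KC kK).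
Qed.

(** Supplies the distinct joint eigenvalues for [exp_poly_independent]: a common exponent would put
    the members of both sets into one class. *)
Lemma mu_inj : {in enum (classes lam) &, injective (mu lam)}.
Proof.
move=> K K'; rewrite !mem_enum => KC K'C E.
case/imsetP: (KC) => k _ EK; case/imsetP: (K'C) => k' _ EK'.
have kK : k \in K by rewrite EK mem_cls.
have kK' : k' \in K' by rewrite EK' mem_cls.
rewrite EK'; apply: (class_of KC); rewrite EK; apply/in_cls.
by rewrite -(mu_class KC kK) E (mu_class K'C kK').
Qed.

Lemma sum_classes (F : 'I_m -> Cplx) :
  (\sum_(k <- enum 'I_m) F k = \sum_(K <- enum (classes lam)) \sum_(j <- enum 'I_#|K|) F (enum_val j))%C.
Proof.
rewrite big_enum /= (partition_big_imset (cls lam)) /=.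
rewrite -[LHS]big_enum /=.
have -> : enum [set cls lam x | x in 'I_m] = enum (classes lam) by [].
apply: eq_big_seq => K; rewrite mem_enum => KC.
rewrite [RHS]big_enum -[RHS](big_enum_val F).
apply: eq_bigl => k; apply/eqP/idP => [<-|kK]; first exact: mem_cls.
by rewrite -(class_of KC kK).
Qed.

Lemma coef_flatten (T : Type) (s : seq T) (F : T -> weyl n) al be :
  coef (flatten (map F s)) al be = (\sum_(k <- s) coef (F k) al be)%C.
Proof.
elim: s => [|k s IH]; rewrite ?big_nil ?big_cons //= -IH.
by rewrite !coefE /lin big_cat.
Qed.

(** An index lies in one class only and [enum_val] is injective, so a single term of the double sum
    survives. Blocks are thus recovered from their sum, which is directness. *)
Lemma dsum_of_class (b : forall K : {set 'I_m}, 'I_#|K| -> weyl n) K (j : 'I_#|K|) :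
  K \in classes lam -> weq (dsum_of lam b (enum_val j)) (b K j).
Proof.
move=> KC al be; rewrite /dsum_of /wsum coef_flatten.
rewrite (bigD1_seq K) ?mem_enum ?enum_uniq //= [X in Cadd _ X]big1_seq.
  rewrite Monoid.mulm1 /phi /wsum coef_flatten big_enum (bigD1 j) //= eqxx [X in Cadd _ X]big1; first by ring.
  by move=> i ij; rewrite (inj_eq enum_val_inj) (negbTE ij).
move=> K' /andP [K'K]; rewrite mem_enum => K'C.
rewrite /phi /wsum coef_flatten big1 // => i _; case: eqP => // E.
case/eqP: K'K; rewrite (class_of KC (enum_valP j)) -E.
exact: class_of K'C (enum_valP i).
Qed.

End Classes.

(** * The annihilator of the signal equals the sum of the blocks *)

Section Kernel.
Variables (n m : nat) (P : 'I_m -> mpoly n) (lam : 'I_m -> 'I_n -> Cplx).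

Lemma sig_pE K k : K \in classes lam -> k \in K ->
  sig_p P lam k = fmul (peval (P k)) (expC (mu lam K)).
Proof. by move=> KC kK; rewrite (mu_class KC kK). Qed.

Lemma Cinf_sig_p k : Cinf (sig_p P lam k).
Proof. by apply: (@exp_poly_Cinf n (lam k)); exists (P k). Qed.

(** A class shares one exponential, so by [act_sigma] its terms add up to the vanishing sum of
    [kerh] times that exponential. *)
Lemma inDS_kerp a : inDS P lam a -> kerp P lam a.
Proof.
case=> b [bH ab] x; rewrite CsumE (sum_classes lam) big1_seq // => K /andP [_].
rewrite mem_enum => KC; have [c [cK bc]] := bH K KC.
transitivity ((\sum_(j <- enum 'I_#|K|) act (c j) (peval (P (enum_val j))) x) * expC (mu lam K) x)%C.
  rewrite big_distrl; apply: eq_bigr => j _ /=.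
  rewrite (weq_act _ (ab _)) (weq_act _ (dsum_of_class b j KC)) (weq_act _ (bc j)).
  by rewrite (sig_pE KC (enum_valP j)) act_sigma //; apply: Cinf_peval.
by have := cK x; rewrite CsumE => ->; ring.
Qed.

(** The preimage of the block at [K] is sigma_{-mu_K} applied to the entries of [a] indexed by [K].
    Its membership in [kerh] is checked after multiplication by the exponential. *)
Lemma kerp_inDS a : kerp P lam a -> inDS P lam a.
Proof.
move=> ka; pose c (K : {set 'I_m}) j := sigma (fun i => - mu lam K i)%C (a (enum_val (A := mem K) j)).
have cE (K : {set 'I_m}) (j : 'I_#|K|) : weq (a (enum_val j)) (sigma (mu lam K) (c K j)) by apply: sigmaK.
exists (fun K j => sigma (mu lam K) (c K j)); split=> [K KC|k]; last first.
  have kK := mem_cls lam k; have KC := cls_in_classes lam k.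
  have := dsum_of_class (fun K j => sigma (mu lam K) (c K j)) (enum_rank_in kK k) KC.
  have := cE _ (enum_rank_in kK k); rewrite enum_rankK_in // => aE dE al be.
  by rewrite aE dE.
exists (c K); split=> // x.
(* [F K] is the part of the annihilation equation that belongs to [K]. Written with [mu lam K] in
   place of the individual exponents, it is an exponential polynomial for every set [K], as the
   independence lemma asks. *)
pose F (K : {set 'I_m}) := fsum (enum 'I_#|K|) (fun j =>
  act (a (enum_val j)) (fmul (peval (P (enum_val j))) (expC (mu lam K)))).
have F0 : F K = @f0 n.
  apply: (@exp_poly_independent n _ (enum (classes lam)) (mu lam) F) => //.
  - exact: enum_uniq.
  - exact: mu_inj.
  - by move=> K'; apply: exp_poly_sum => j; apply: exp_poly_act; exists (P (enum_val j)).
  - apply: functional_extensionality => y; rewrite [RHS]/f0 -[RHS](ka y) CsumE (sum_classes lam).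
    apply: eq_big_seq => K'; rewrite mem_enum => K'C.
    by apply: eq_bigr => j _; rewrite (sig_pE K'C (enum_valP j)).
  - by rewrite mem_enum.
have FE : F K = fmul (fsum (enum 'I_#|K|) (fun j => act (c K j) (peval (P (enum_val j))))) (expC (mu lam K)).
  apply: functional_extensionality => y; rewrite /F /fsum /fmul big_distrl; apply: eq_bigr => j _ /=.
  by rewrite (weq_act _ (cE K j)) act_sigma //; apply: Cinf_peval.
have := f_equal (@^~ x) FE; rewrite F0 /fmul => /esym/Cmul_eq0 [H|E]; first by rewrite CsumE.
by have := expCN (mu lam K) x; rewrite E => /(f_equal Re) /=; lra.
Qed.

End Kernel.

(** * Kernel representations and generated row modules *)

Lemma genby_row (n m r : nat) (Rm : 'I_r -> 'I_m -> weyl n) k : genby Rm (Rm k).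
Proof.
exists (fun l => if l == k then [:: (C1, (@mi0 n, @mi0 n))] else @wzero n) => j al be.
rewrite /wsum coef_flatten big_enum (bigD1 k) //= eqxx big1 => [|l lk]; last by rewrite (negbTE lk).
have -> : wmul [:: (C1, (@mi0 n, @mi0 n))] (Rm k j) = wscale C1 (Rm k j).
  rewrite /wmul /= cats0 /tpow /dpoww.
  by elim: (enum _) => //=; elim: (enum _).
have -> : wscale C1 (Rm k j) = Rm k j.
  rewrite /wscale -[RHS]map_id; apply: eq_map => -[c t] /=; congr pair; ring.
ring.
Qed.

(** After exchanging the sums, each [c k] acts on the function to which row [k] sends [g], and this
    is zero. Smoothness of [g] provides the additivity and the module law. *)
Lemma genby_ann (n m r : nat) (Rm : 'I_r -> 'I_m -> weyl n) a g :
  genby Rm a -> (forall j, Cinf (g j)) -> (forall k, ann (Rm k) g) -> ann a g.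
Proof.
case=> c ac Cg Rg x.
have C k j : Cinf (act (Rm k j) (g j)) by apply: Cinf_act.
have R0 k : fsum (enum 'I_m) (fun j => act (Rm k j) (g j)) = @f0 n.
  by apply: functional_extensionality => y; rewrite /fsum -CsumE; apply: Rg.
transitivity (\sum_(k <- enum 'I_r) act (c k) (fsum (enum 'I_m) (fun j => act (Rm k j) (g j))) x)%C.
  under [RHS]eq_bigr => k _ do rewrite act_sum //.
  rewrite CsumE [RHS]exchange_big; apply: eq_bigr => j _ /=.
  rewrite (weq_act _ (ac j)) /wsum act_flatten /fsum.
  by apply: eq_bigr => k _; rewrite act_wmul.
by rewrite big1 // => k _; rewrite R0 act_f0.
Qed.

Theorem theorem5p7 (n m : nat) (P : 'I_m -> mpoly n) (lam : 'I_m -> 'I_n -> Cplx) :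
  (forall a : 'I_m -> weyl n, kerp P lam a <-> inDS P lam a) /\
  DS_direct P lam /\
  (forall (r : nat) (Rm : 'I_r -> 'I_m -> weyl n),
      (forall a, genby Rm a <-> inDS P lam a) -> vmpum_rep Rm (sig_p P lam)).
Proof.
split; first by move=> a; split; [apply: kerp_inDS | apply: inDS_kerp].
(* Directness: entry [enum_val j] of the sum is [b K j] itself. *)
split=> [b _ b0 K KC j al be|r Rm gen].
  by rewrite -(dsum_of_class b j KC) b0.
split.
  split=> [j|k]; first exact: Cinf_sig_p.
  by apply: inDS_kerp; apply/gen; apply: genby_row.
(* Minimality: the rows of [R'] annihilate the signal, so they are generated by [Rm] and annihilate
   every solution of [Rm]. *)
move=> r' R' [_ R'p] g [Cg Rg]; split=> // k.
by apply: (genby_ann _ Cg Rg); apply/gen; apply: kerp_inDS; apply: R'p.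
Qed.
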